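(* Let $F_m$ denote the $m$-th Fibonacci polynomial and $F_m'''$ its third derivative. For any odd number $s\in 1+2\mathbb{Z}_2$: 1. $F_{3\cdot 2^{l}}'''(s)\equiv 0$, $F_{3\cdot 2^{l}+1}'''(s)\equiv 0$ and $F_{3\cdot 2^{l}+2}'''(s)\equiv 2^{l}$, all modulo $2^{l+1}$, for any positive integer $l$; 2. the sequence $\{F_m'''(s) \bmod 2^{l+1}\}_{m\ge 0}$ is periodic of period $3\cdot 2^{l+1}$ for any positive integer $l$.
   Context: $\mathbb{Z}_2$ is the ring of 2-adic integers. The Fibonacci polynomials are defined by $F_0(x)=0$, $F_1(x)=1$, $F_m(x)=xF_{m-1}(x)+F_{m-2}(x)$ for $m\ge 2$. A sequence $\{f_m\}_{m\ge 0}$ is called periodic of period $d$ if $d$ is the least positive integer such that $f_{m+d}=f_m$ for every $m$. *)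

(* Defs.v *)
From HB Require Import structures.
From mathcomp Require Import all_boot all_order all_algebra.
From mathcomp Require Import boolp classical_sets.

Set Implicit Arguments.
Unset Strict Implicit.
Unset Printing Implicit Defensive.

Import GRing.Theory.
Local Open Scope ring_scope.

Definition Zpow2_proj n (a : 'Z_(2 ^ n.+2)) : 'Z_(2 ^ n.+1) := (a : nat)%:R.

(* The ring of 2-adic integers, as the inverse limit of the rings Z/2^(n+1):
   component n of x is the residue of x modulo 2^(n+1). The limit starts at
   Z/2 because 'Z_1 does not denote the zero ring. *)
Record Z2 := MkZ2 {
  Z2res :> forall n, 'Z_(2 ^ n.+1);
  Z2res_proj : forall n, Zpow2_proj (Z2res n.+1) = Z2res n }.

Lemma pow2S_gt1 n : (1 < 2 ^ n.+1)%N.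
Proof. by rewrite -{1}(expn0 2) ltn_exp2l. Qed.

Lemma Zpow2_proj_nat n a : Zpow2_proj (a%:R : 'Z_(2 ^ n.+2)) = a%:R.
Proof.
rewrite /Zpow2_proj val_Zp_nat ?pow2S_gt1// -[LHS]Zp_nat_mod ?pow2S_gt1//.
by rewrite modn_dvdm ?Zp_nat_mod ?pow2S_gt1// dvdn_exp2l.
Qed.

Lemma Zpow2_projD n : {morph @Zpow2_proj n : a b / a + b}.
Proof.
move=> a b; rewrite -[a]natr_Zp -[b]natr_Zp -natrD !Zpow2_proj_nat.
by rewrite natrD.
Qed.

Lemma Zpow2_projM n : {morph @Zpow2_proj n : a b / a * b}.
Proof.
move=> a b; rewrite -[a]natr_Zp -[b]natr_Zp -natrM !Zpow2_proj_nat.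
by rewrite natrM.
Qed.

Lemma Zpow2_projN n : {morph @Zpow2_proj n : a / - a}.
Proof.
move=> a; apply/eqP; rewrite -subr_eq0 opprK -Zpow2_projD addNr.
by rewrite (Zpow2_proj_nat n 0).
Qed.

Lemma Z2_ext (x y : Z2) : (forall n, x n = y n) -> x = y.
Proof.
case: x y => [x hx] [y hy] /= xy.
have {}xy : x = y by apply: functional_extensionality_dep.
by subst y; congr MkZ2; apply: Prop_irrelevance.
Qed.

HB.instance Definition _ := gen_eqMixin Z2.
HB.instance Definition _ := gen_choiceMixin Z2.

Lemma Z2add_proj (x y : Z2) n : Zpow2_proj (x n.+1 + y n.+1) = x n + y n.
Proof. by rewrite Zpow2_projD !Z2res_proj. Qed.
Lemma Z2mul_proj (x y : Z2) n : Zpow2_proj (x n.+1 * y n.+1) = x n * y n.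
Proof. by rewrite Zpow2_projM !Z2res_proj. Qed.
Lemma Z2opp_proj (x : Z2) n : Zpow2_proj (- x n.+1) = - x n.
Proof. by rewrite Zpow2_projN Z2res_proj. Qed.

Definition Z2zero : Z2 := @MkZ2 (fun=> 0) (fun n => Zpow2_proj_nat n 0).
Definition Z2one : Z2 := @MkZ2 (fun=> 1) (fun n => Zpow2_proj_nat n 1).
Definition Z2opp (x : Z2) : Z2 := @MkZ2 (fun n => - x n) (Z2opp_proj x).
Definition Z2add (x y : Z2) : Z2 := @MkZ2 (fun n => x n + y n) (Z2add_proj x y).
Definition Z2mul (x y : Z2) : Z2 := @MkZ2 (fun n => x n * y n) (Z2mul_proj x y).

Lemma Z2addA : associative Z2add.
Proof. by move=> x y z; apply: Z2_ext => n /=; rewrite addrA. Qed.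
Lemma Z2addC : commutative Z2add.
Proof. by move=> x y; apply: Z2_ext => n /=; rewrite addrC. Qed.
Lemma Z2add0 : left_id Z2zero Z2add.
Proof. by move=> x; apply: Z2_ext => n /=; rewrite add0r. Qed.
Lemma Z2addN : left_inverse Z2zero Z2opp Z2add.
Proof. by move=> x; apply: Z2_ext => n /=; rewrite addNr. Qed.

HB.instance Definition _ := GRing.isZmodule.Build Z2 Z2addA Z2addC Z2add0 Z2addN.

Lemma Z2mulA : associative Z2mul.
Proof. by move=> x y z; apply: Z2_ext => n /=; rewrite mulrA. Qed.
Lemma Z2mulC : commutative Z2mul.
Proof. by move=> x y; apply: Z2_ext => n /=; rewrite mulrC. Qed.
Lemma Z2mul1 : left_id Z2one Z2mul.
Proof. by move=> x; apply: Z2_ext => n /=; rewrite mul1r. Qed.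
Lemma Z2mulDl : left_distributive Z2mul Z2add.
Proof. by move=> x y z; apply: Z2_ext => n /=; rewrite mulrDl. Qed.
Lemma Z2one_neq0 : Z2one != 0.
Proof.
apply/eqP => /(congr1 (fun x : Z2 => x 0%N)) /= h.
by have := oner_neq0 'Z_(2 ^ 1); rewrite h eqxx.
Qed.

HB.instance Definition _ := GRing.Zmodule_isComNzRing.Build Z2
  Z2mulA Z2mulC Z2mul1 Z2mulDl Z2one_neq0.

Fixpoint fibp (R : nzRingType) (m : nat) : {poly R} :=
  match m with
  | 0 => 0
  | m1.+1 => match m1 with
             | 0 => 1
             | m2.+1 => 'X * fibp R m1 + fibp R m2
             end
  end.

Definition eqmod (R : comNzRingType) (q a b : R) : Prop :=
  exists c, a - b = q * c.

Definition residue_class (R : comNzRingType) (q a : R) : set R :=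
  [set b | eqmod q b a].

Definition periodic_of_period (T : Type) (f : nat -> T) (d : nat) : Prop :=
  [/\ (0 < d)%N,
      forall m, f (m + d)%N = f m
    & forall e, (0 < e)%N -> (forall m, f (m + e)%N = f m) -> (d <= e)%N].

(* Main.v *)
Require Import Defs.
From mathcomp Require Import all_boot all_order all_algebra.
From mathcomp Require Import boolp classical_sets.
From mathcomp Require Import ring.

Import GRing.Theory.
Local Open Scope ring_scope.

(** Put [Y = X - s] and [N = 3 * 2 ^ k.+1].  Taylor expansion at [s] shows that
    a polynomial in the ideal [(2 ^ k, Y ^ 4)] has a third derivative at [s]
    divisible by [2 ^ k.+1]: the multiples of [Y ^ 4] contribute nothing, and a
    third derivative always carries the even factor [3! = 6]
    ([eqjet_derivn3]).  So it is enough to know the Fibonacci polynomials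
    modulo such ideals, that is, as truncated power series in [Y].

    The key fact ([fibp_jet]) is
      [F_N = 0] and [F_(N+1) = 1 + 2 ^ k * Y ^ 2] modulo [(2 ^ k.+1, Y ^ 4)].
    For [k = 0] it is a computation with [F_6] and [F_7], in which [s] odd gives
    [Y ^ 4 = X ^ 4 + 1] modulo 2.  The passage from [N] to [2 * N] uses the
    duplication formulas; squaring [1 + 2 ^ k * Y ^ 2] doubles the coefficient
    of [Y ^ 2] and kills the next term because it is a multiple of [Y ^ 4].

    Differentiating three times [F_N], [F_(N+1)] and [F_(N+2) = X F_(N+1) + F_N]
    gives the three congruences.  As [F_N = 0] and [F_(N+1) = 1] modulo
    [(2 ^ k, Y ^ 4)], the addition formula shows that [F_(m+N)] and [F_m] are
    congruent there, so that [N] is a period modulo [2 ^ k.+1]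
    ([fibp_derivn3_period]).

    A period [d] is the least one as soon as no [d / p], with [p] a prime divisor
    of [d], is a period ([periodic_of_period_prime]).  Here [p] is 2 or 3.  Half of
    the period is excluded by the third congruence, since [F_2''' = 0] and
    [2 ^ l] is not divisible by [2 ^ l.+1].  A third of the period is a power of
    2; were it a period, then modulo 4 its gcd with 12, namely 4, would be a
    period too, contrary to [F_4''' = 6] and [F_0''' = 0]. *)

(** * Congruences and residue classes *)

Section Eqmod.
Variables (R : comNzRingType) (q : R).

Lemma eqmodxx a : eqmod q a a.
Proof. by exists 0; ring. Qed.

Lemma eqmod_sym a b : eqmod q a b -> eqmod q b a.
Proof. by case=> c E; exists (- c); rewrite mulrN -E opprB. Qed.

Lemma eqmod_trans a b c : eqmod q a b -> eqmod q b c -> eqmod q a c.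
Proof. by case=> x Ex [y Ey]; exists (x + y); rewrite mulrDr -Ex -Ey; ring. Qed.

Lemma eqmod_dvd r a b : eqmod (q * r) a b -> eqmod q a b.
Proof. by case=> c E; exists (r * c); rewrite mulrA. Qed.

Lemma residue_classP a b : residue_class q a = residue_class q b <-> eqmod q a b.
Proof.
split=> [E|ab]; first by have: residue_class q a a; [exact: eqmodxx|rewrite E].
apply/seteqP; split=> c h; apply: eqmod_trans h _ => //; exact: eqmod_sym.
Qed.

End Eqmod.

Section Z2Residues.
Variable n : nat.

Lemma Z2res_natr k : Z2res (k%:R : Z2) n = k%:R.
Proof. by elim: k => [|k IHk] //; rewrite -[k.+1]addn1 !natrD -IHk. Qed.

Lemma Z2_eqmod_natr0 k : eqmod (2%:R ^+ n.+1 : Z2) k%:R 0 -> (2 ^ n.+1 %| k)%N.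
Proof.
case=> c; rewrite subr0 -natrX => /(congr1 (fun x : Z2 => x n)).
rewrite Z2res_natr /= -/(Z2res (2 ^ n.+1)%:R n) Z2res_natr.
rewrite pchar_Zp ?pow2S_gt1// mul0r => /(congr1 val) /=.
by rewrite val_Zp_nat ?pow2S_gt1// => /eqP.
Qed.

End Z2Residues.

(** * Periods of sequences *)

Section Periods.
Variables (T : Type) (f : nat -> T).

Lemma period_mul a k :
  (forall m, f (m + a)%N = f m) -> forall m, f (m + k * a)%N = f m.
Proof.
by move=> fa m; elim: k => [|k IHk]; rewrite ?addn0// mulSn addnCA addnC fa.
Qed.

Lemma period_gcd a b : (0 < a)%N ->
  (forall m, f (m + a)%N = f m) -> (forall m, f (m + b)%N = f m) ->
  forall m, f (m + gcdn a b)%N = f m.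
Proof.
move=> a_gt0 fa fb m; case: (egcdnP b a_gt0) => ka kb E _.
by rewrite -(period_mul _ kb fb) addnAC -addnA -E (period_mul _ ka fa).
Qed.

(** If a smaller period existed, its gcd [g] with [d] would be a proper divisor
    of [d], and for a prime [p] dividing [d / g] the multiple [d / p] of [g]
    would be a period. *)
Lemma periodic_of_period_prime d : (0 < d)%N ->
  (forall m, f (m + d)%N = f m) ->
  (forall p, prime p -> (p %| d)%N -> ~ forall m, f (m + d %/ p)%N = f m) ->
  periodic_of_period f d.
Proof.
move=> d_gt0 fd fp; split=> // e e_gt0 fe.
have fg := period_gcd _ _ e_gt0 fe fd; set g := gcdn e d in fg.
have g_gt0 : (0 < g)%N by rewrite gcdn_gt0 e_gt0.
have /dvdnP[c def_d] : (g %| d)%N by exact: dvdn_gcdr.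
case: (eqVneq c 1%N) => [c1|c_neq1].
  by rewrite def_d c1 mul1n dvdn_leq// dvdn_gcdl.
have p_pr : prime (pdiv c).
  rewrite pdiv_prime// ltn_neqAle eq_sym c_neq1 lt0n.
  by apply: contraTneq d_gt0 => c0; rewrite def_d c0.
have pc := pdiv_dvd c.
case: (fp _ p_pr); first by rewrite def_d dvdn_mulr.
by rewrite def_d -divn_mulAC//; apply: period_mul.
Qed.

End Periods.

(** * Fibonacci polynomials *)

Section Fibonacci.
Variable R : comNzRingType.
Local Notation F := (fibp R).

Lemma fibpSS m : F m.+2 = 'X * F m.+1 + F m.
Proof. by []. Qed.

Lemma fibp_add m n : F (m + n).+1 = F m.+1 * F n.+1 + F m * F n.
Proof.
suff [] : F (m + n).+1 = F m.+1 * F n.+1 + F m * F n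
   /\ F (m + n).+2 = F m.+2 * F n.+1 + F m.+1 * F n by [].
elim: m => [|m [IH1 IH2]].
  by rewrite add0n !fibpSS /=; split; ring.
by rewrite addSn; split=> //; rewrite fibpSS IH1 IH2 !fibpSS; ring.
Qed.

Lemma fibp_double m : F (2 * m) = F m * (2%:R * F m.+1 - 'X * F m).
Proof.
case: m => [|m]; first by rewrite mul0r.
have -> : (2 * m.+1 = (m.+1 + m).+1)%N by rewrite mul2n -addnn addnS.
by rewrite fibp_add fibpSS; ring.
Qed.

Lemma fibp_doubleS m : F (2 * m).+1 = F m.+1 ^+ 2 + F m ^+ 2.
Proof. by rewrite mul2n -addnn fibp_add; ring. Qed.

Lemma fibp2_derivn3 : (F 2)^`(3) = 0.
Proof. by have -> : F 2 = 'X^1 by [rewrite /=; ring]; rewrite derivnXn. Qed.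

Lemma fibp4_derivn3 : (F 4)^`(3) = 6%:R.
Proof.
have -> : F 4 = 'X^3 + 'X^1 *+ 2 by rewrite /=; ring.
rewrite derivnD derivnMn !derivnXn (ffact_small (isT : 1 < 3)%N).
by rewrite mulr0n mul0rn addr0.
Qed.

End Fibonacci.

(** * Congruences of jets of order 3 *)

Section Jets.
Variables (R : comNzRingType) (s : R).
Local Notation F := (fibp R).
Local Notation Y := ('X - s%:P).

(** Congruence modulo the ideal [(2 ^ k, Y ^ 4)] of [{poly R}]. *)
Definition eqjet k (p r : {poly R}) :=
  exists a b : {poly R}, p - r = 2%:R ^+ k * a + Y ^+ 4 * b.

(** The gain of one power of 2 is the even factor [3!] of a third derivative. *)
Lemma eqjet_derivn3 k p r : eqjet k p r ->
  eqmod (2%:R ^+ k.+1) p^`(3).[s] r^`(3).[s].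
Proof.
case=> a [b E]; exists (3%:R * a^`N(3).[s]).
rewrite -hornerN -hornerD -derivnB E derivnD -natrX mulr_natl derivnMn.
rewrite [a^`(3)]nderivn_def hornerD !hornerMn.
have -> : (Y ^+ 4 * b)^`(3).[s] = 0.
  have derivY n (c : {poly R}) :
      exists d : {poly R}, (Y ^+ n.+1 * c)^`() = Y ^+ n * d.
    exists (n.+1%:R * c + Y * c^`()).
    by rewrite derivM deriv_exp derivXsubC mul1r exprS /= -mulr_natl; ring.
  have [b1 E1] := derivY 3 b; have [b2 E2] := derivY 2 b1.
  have [b3 E3] := derivY 1 b2.
  by rewrite !derivnS derivn0 E1 E2 E3 hornerM hornerXsubC subrr mul0r.
rewrite addr0 -mulr_natl natrX -[X in _ * X]mulr_natl exprS.
by have -> : 3`!%:R = 6%:R :> R by []; ring.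
Qed.

(** Modulo [2 ^ k.+1], the jet at [s] of [F_(3 * 2 ^ k.+1 + 1)] ([fibp_jet]). *)
Definition jet k : {poly R} := 1 + 2%:R ^+ k * Y ^+ 2.

Lemma jet_derivn2 k : (jet k)^`(2) = (2%:R ^+ k.+1)%:P.
Proof.
rewrite /jet -natrX mulr_natl derivnD derivnMn -polyC1 derivnC add0r.
rewrite derivSn deriv_exp derivXsubC mul1r derivnMn derivn1 derivXsubC.
by rewrite -mulrnA -natrX expnS polyCMn.
Qed.

Lemma jet_derivn3 k : (jet k)^`(3) = 0.
Proof. by rewrite derivnS jet_derivn2 derivC. Qed.

Lemma jetMX_derivn3 k : (jet k * 'X)^`(3) = (2%:R ^+ k.+1 *+ 3)%:P.
Proof.
have := derivnMXaddC 2 (jet k) 0; rewrite polyC0 addr0 => ->.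
by rewrite jet_derivn3 mul0r addr0 jet_derivn2 polyCMn.
Qed.

(** The step doubles the index [N].  In [F_(2N) = F_N * (2 F_(N+1) - X F_N)] both
    factors are even modulo [Y ^ 4], whence one more power of 2 in [F_(2N)].  In
    [F_(2N+1) = F_(N+1) ^ 2 + F_N ^ 2] the last square is negligible and, with
    [q = 2 ^ k], [(1 + q * Y ^ 2) ^ 2 = 1 + 2 * q * Y ^ 2] modulo [Y ^ 4]. *)
Lemma fibp_jet k : (exists t, s = 1 + 2%:R * t) ->
  eqjet k.+1 (F (3 * 2 ^ k.+1)) 0 /\
  eqjet k.+1 (F (3 * 2 ^ k.+1).+1) (jet k).
Proof.
case=> t def_s; elim: k => [|k [[a [b Ea]] [c [d Ec]]]].
  rewrite /eqjet /jet.
  have -> : s%:P = 1 + 2%:R * t%:P by rewrite def_s polyCD polyCM polyCMn polyC1.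
  (* Modulo 2, [F_6 = X * (X + 1) ^ 4] and [F_7 = 1 + (X + 1) ^ 2 + (X + 1) ^ 6];
     [w] is half the difference between [(X - 1) ^ 4] and [Y ^ 4]. *)
  set T := t%:P; pose z : {poly R} := 'X - 1.
  pose w := 4%:R * T * z ^+ 3 - 12%:R * T ^+ 2 * z ^+ 2 + 16%:R * T ^+ 3 * z
            - 8%:R * T ^+ 4.
  have -> : (3 * 2 ^ 1 = 6)%N by [].
  rewrite !fibpSS /=; split.
    exists ('X * (2%:R * 'X ^+ 3 - 'X ^+ 2 + 2%:R * 'X + 1 + w)), 'X.
    by rewrite /w /z; ring.
  exists (2%:R * 'X ^+ 5 - 'X ^+ 4 + 4%:R * 'X ^+ 3 - 'X ^+ 2 + 3%:R * 'X - 1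
          + 2%:R * T * z - 2%:R * T ^+ 2 + ('X ^+ 2 + 1) * w), ('X ^+ 2 + 1).
  by rewrite /w /z; ring.
rewrite [(2 ^ k.+2)%N]expnS mulnCA; move: Ea Ec; set n := (3 * _)%N.
rewrite subr0 /eqjet /jet fibp_double fibp_doubleS !exprSr subr0.
move: (F n) (F n.+1) (2%:R ^+ k) => u v q Eu /eqP; rewrite subr_eq => /eqP Ev.
split.
  exists (a * (v - 'X * q * a)), (b * (2%:R * v - 'X * u) - 2%:R * q * a * 'X * b).
  by rewrite Eu; ring.
exists (c * (1 + q * Y ^+ 2) + q * c ^+ 2 + q * a ^+ 2).
exists (q ^+ 2 + 2%:R * (1 + q * Y ^+ 2 + 2%:R * q * c) * d + Y ^+ 4 * d ^+ 2
        + (4%:R * q * a * b + Y ^+ 4 * b ^+ 2)).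
by rewrite Eu Ev; ring.
Qed.

(** In the addition formula for [F_(m + N)], only [F_N = 0] and [F_(N+1) = 1]
    modulo [(2 ^ k, Y ^ 4)] matter: the term [2 ^ k * Y ^ 2] of [F_(N+1)] is
    absorbed by the ideal. *)
Lemma fibp_derivn3_period k m : (exists t, s = 1 + 2%:R * t) ->
  eqmod (2%:R ^+ k.+1) (F (m + 3 * 2 ^ k.+1))^`(3).[s] (F m)^`(3).[s].
Proof.
move=> s_odd; apply: eqjet_derivn3.
have [[a [b Ea]] [c [d Ec]]] := fibp_jet k s_odd.
move: Ea Ec; set n := (3 * _)%N; rewrite /jet subr0 exprS.
move=> Ea /eqP; rewrite subr_eq => /eqP Ec.
case: m => [|m].
  by exists (2%:R * a), b; rewrite add0n subr0 Ea; ring.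
exists (F m.+1 * (2%:R * c + Y ^+ 2) + F m * (2%:R * a)), (F m.+1 * d + F m * b).
by rewrite addSn fibp_add Ea Ec; ring.
Qed.

End Jets.

Theorem lemma2p11 (s : Z2) (hs : exists t : Z2, s = 1 + 2%:R * t) :
  (forall l : nat, (0 < l)%N ->
     [/\ eqmod (2%:R ^+ l.+1) ((fibp Z2 (3 * 2 ^ l))^`(3)).[s] 0,
         eqmod (2%:R ^+ l.+1) ((fibp Z2 (3 * 2 ^ l + 1))^`(3)).[s] 0
       & eqmod (2%:R ^+ l.+1) ((fibp Z2 (3 * 2 ^ l + 2))^`(3)).[s] (2%:R ^+ l)])
  /\
  (forall l : nat, (0 < l)%N ->
     periodic_of_period
       (fun m : nat => residue_class (2%:R ^+ l.+1) ((fibp Z2 m)^`(3)).[s])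
       (3 * 2 ^ l.+1)).
Proof.
have part1 l : (0 < l)%N ->
  [/\ eqmod (2%:R ^+ l.+1) ((fibp Z2 (3 * 2 ^ l))^`(3)).[s] 0,
      eqmod (2%:R ^+ l.+1) ((fibp Z2 (3 * 2 ^ l + 1))^`(3)).[s] 0
    & eqmod (2%:R ^+ l.+1) ((fibp Z2 (3 * 2 ^ l + 2))^`(3)).[s] (2%:R ^+ l)].
  case: l => // k _; have [EN ENS] := fibp_jet _ _ k hs.
  have := eqjet_derivn3 _ _ _ _ _ EN; have := eqjet_derivn3 _ _ _ _ _ ENS.
  rewrite addn1 addn2 jet_derivn3 linear0 horner0; set N := (3 * _)%N => D1 D0.
  split=> //.
  have E : eqjet _ s k.+1 (fibp Z2 N.+2) (jet _ s k * 'X).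
    case: EN ENS => a [b Ea] [c [d /eqP]]; rewrite subr_eq => /eqP Ec.
    exists ('X * c + a), ('X * d + b); rewrite subr0 in Ea.
    by rewrite fibpSS Ea Ec; ring.
  apply: eqmod_trans (eqjet_derivn3 _ _ _ _ _ E) _; exists 1.
  by rewrite jetMX_derivn3 hornerC !exprS; ring.
split=> // l l_gt0; apply: periodic_of_period_prime.
- by rewrite muln_gt0 expn_gt0.
- by move=> m; apply/residue_classP; apply: fibp_derivn3_period.
move=> p p_pr; rewrite Euclid_dvdM// Euclid_dvdX//= => p_dvd per.
have /orP[/eqP p3|/eqP p2] : (p == 3) || (p == 2).
  by move: p_dvd; rewrite !dvdn_prime2//= andbT.
- (* [2 ^ l.+1] would be a period modulo 4, as 12 is, hence also their gcd 4. *)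
  have per2 m : residue_class (2%:R ^+ 2) (fibp Z2 (m + 2 ^ l.+1))^`(3).[s]
              = residue_class (2%:R ^+ 2) (fibp Z2 m)^`(3).[s].
    move: (per m); rewrite p3 mulKn// => /residue_classP h.
    apply/residue_classP; apply: (eqmod_dvd _ _ (2%:R ^+ l.-1)).
    by rewrite -exprD add2n prednK.
  have per12 m : residue_class (2%:R ^+ 2) (fibp Z2 (m + 12))^`(3).[s]
               = residue_class (2%:R ^+ 2) (fibp Z2 m)^`(3).[s].
    by apply/residue_classP; apply: (fibp_derivn3_period _ _ 1).
  have g4 : gcdn 12 (2 ^ l.+1) = 4.
    rewrite -(prednK l_gt0) !expnSr -mulnA -[12%N]/(3 * 4)%N -muln_gcdl.
    by have /eqP -> : coprime 3 (2 ^ l.-1) by apply: coprimeXr.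
  have := period_gcd _ (fun m => residue_class (2%:R ^+ 2) (fibp Z2 m)^`(3).[s])
            12 _ isT per12 per2 0%N.
  rewrite g4 => /residue_classP.
  rewrite fibp4_derivn3 linear0 horner0 hornerMn hornerC.
  by move=> /(Z2_eqmod_natr0 1 6).
- move: (per 2%N); rewrite p2 expnSr mulnA mulnK// addnC => /residue_classP h.
  have [_ _ /eqmod_sym h'] := part1 l l_gt0.
  have: eqmod _ _ (fibp Z2 2)^`(3).[s] := eqmod_trans _ _ _ _ _ h' h.
  rewrite fibp2_derivn3 horner0.
  by rewrite -[X in eqmod _ X]natrX => /(Z2_eqmod_natr0 l); rewrite dvdn_Pexp2l// ltnn.
Qed.
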